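(* For the noise-free 2-leader selection problem in a perfect binary tree with root $r$, height $h\ge 4$ and $n$ nodes, the optimal leaders $x,y$ (with lowest common ancestor $r$) are such that $d_{xy}=4$ and $d_{xr}=2$, and the resulting coherence, with $S=\{x,y\}$, is $$ R_{NF}(S)=\frac{n+1}{2}\left(\log_2(n+1)-\frac{25}{8}\right)+\frac72 . $$
   Context: A perfect binary tree is a rooted tree in which all non-leaf nodes have exactly $2$ children and all leaves are on the same level; the root is at level $0$ and the leaves at level $h$ (the height), so $n=2^{h+1}-1$. All edge weights equal $1$, and $d_{uv}$ is the graph distance (number of edges) between $u$ and $v$. The two leaders are denoted $x$ and $y$, their lowest common ancestor is taken to be the root $r$, and they are labelled so that the level of $x$ is at most the level of $y$. For a connected graph with node set $V$ and Laplacian $L$, and a nonempty leader set $S\subseteq V$, let $L_{ff}$ be the principal submatrix of $L$ indexed by the followers $V\setminus S$. The coherence for noise-free leaders $S$ (total steady-state variance of the followers under $\dot x_f=-L_{ff}x_f+d_f$, where $x_f$ is the vector of follower states and $d_f$ is a vector of zero-mean unit-variance white noise processes) is $$R_{NF}(S)=\tfrac12\operatorname{tr}(L_{ff}^{-1}).$$ The noise-free 2-leader selection problem is to minimize $R_{NF}(S)$ over nonempty $S\subseteq V$ with $|S|\le 2$.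
   Formalization: That every optimal pair has d_xy=4 and d_xr=2 is claimed only for h>4: at h=4 a pair with d_xy=3, d_xr=1 ties at 67/2; for h=4 it is still proved that the pairs with d_xy=4, d_xr=2 are optimal with the stated coherence. *)

(* Defs.v *)
(* MathComp / MathComp-Analysis *)
From mathcomp Require Import all_boot all_order all_algebra.
From mathcomp Require Import reals exp.

Set Implicit Arguments.
Unset Strict Implicit.
Unset Printing Implicit Defensive.

Import Order.TTheory GRing.Theory Num.Theory.

Local Open Scope ring_scope.

Section Graph.

Variables (T : finType) (e : rel T).

Definition simple_graph : Prop := symmetric e /\ irreflexive e.

Definition connected : Prop := forall u v : T, connect e u v.

(* Traversing an edge back and forth is a [ucycle] of size 2, so the cycles in
   the graph-theoretic sense are the ucycles of size at least 3. *)
Definition acyclic : Prop := forall c : seq T, ucycle e c -> (size c < 3)%N.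

Definition tree : Prop := [/\ simple_graph, connected & acyclic].

Definition walk_of_length (k : nat) (u v : T) : bool :=
  [exists p : k.-tuple T, path e u p && (last u p == v)].

(* A shortest walk has fewer than #|T| edges; the value is #|T| when [v] is not
   reachable from [u]. *)
Definition dist (u v : T) : nat :=
  \big[minn/#|T|]_(k < #|T| | walk_of_length k u v) k.

Section Rooted.

Variable r : T.

Definition level (v : T) : nat := dist r v.

Definition children (v : T) : {set T} :=
  [set w | e v w & level w == (level v).+1].

Definition leaf (v : T) : bool := children v == set0.

Definition perfect_binary_tree (h : nat) : Prop :=
  [/\ tree,
      forall v : T, ~~ leaf v -> #|children v| = 2%N
    & forall v : T, leaf v -> level v = h].

(* A node is an ancestor of itself. *)
Definition ancestor (a v : T) : bool :=
  connect (fun u w => w \in children u) a v.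

Definition lowest_common_ancestor (a x y : T) : Prop :=
  [/\ ancestor a x, ancestor a y
    & forall b : T, ancestor b x -> ancestor b y -> (level b <= level a)%N].

End Rooted.

Section Coherence.

Variable R : realType.

Definition laplacian : 'M[R]_#|T| :=
  \matrix_(i, j) (#|[set w | e (enum_val i) w]|%:R *+ (i == j)
                  - (e (enum_val i) (enum_val j))%:R).

Definition follower_index (S : {set T}) (i : 'I_#|~: S|) : 'I_#|T| :=
  enum_rank (enum_val i).

Definition laplacian_ff (S : {set T}) : 'M[R]_#|~: S| :=
  mxsub (@follower_index S) (@follower_index S) laplacian.

(* For a connected graph and S nonempty, [laplacian_ff S] is invertible, so that
   [invmx] is the genuine inverse. *)
Definition R_NF (S : {set T}) : R := \tr (invmx (laplacian_ff S)) / 2.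

Definition nf_optimal (k : nat) (S : {set T}) : Prop :=
  [/\ S != set0, (#|S| <= k)%N
    & forall S' : {set T}, S' != set0 -> (#|S'| <= k)%N -> R_NF S <= R_NF S'].

End Coherence.

End Graph.

Definition log2 (R : realType) (t : R) : R := ln t / ln 2.

(* Main.v *)
Require Import Defs.
From mathcomp Require Import all_boot all_order all_algebra.
From mathcomp Require Import reals exp.
From mathcomp Require Import zify ring lra.

(** The proof reduces the coherence to effective resistances and then to a
    function of three integers.

    The diagonal entry of the inverse of the follower block at [u] is the
    effective resistance between [u] and the set of leaders joined together.  In
    a tree this is explicit.  The only fact about distances that it needs is that
    from [u] exactly one edge leads closer to a given [v] while the others lead away
    ([tree_step_unique]); it determines the Laplacian of the distance function
    ([lap_dist]).  Hence the Gromov product based at [x] is the Green function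
    of the tree grounded at [x] ([lap_gromov]), and subtracting a rank-one term
    grounds a second node ([R_NF2]).  The inverse matrix is thus exhibited, not
    computed, and its trace only involves the sums over [u] of the distances
    to each leader and of the squared difference of the two distances
    ([R_NF2_sums]).

    In a perfect binary tree both sums have closed forms, since moving a leader
    from a node to a child changes all distances by one, with a sign given by
    membership in the subtree of the child, whose size is known
    ([distsum_child], [sqdiffsum_child]).  So the coherence of a pair depends
    only on the level c of its lowest common ancestor and on the depths a and b
    of the leaders below it.  Up to the factor 1/2 it exceeds the claimed optimum
    by [excess], a function of c, a, b and N = 2^(h+1) ([R_NF2_excess]).

    It remains to see that this excess is nonnegative for N >= 32.  It is
    positive when c > 0, because most nodes then lie outside the branch holding
    the leaders; for c = 0 it vanishes at a = b = 2, equals (N - 32) / 24 at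
    depths 1 and 2, and is positive elsewhere ([excess_trichotomy]).  This also
    gives uniqueness as soon as h > 4.  A single leader is never optimal, since
    any second leader strictly reduces the coherence ([R_NF_second_leader]). *)

Set Implicit Arguments.
Unset Strict Implicit.
Unset Printing Implicit Defensive.

Import Order.TTheory GRing.Theory Num.Theory.

Local Open Scope ring_scope.

(** * Distances in connected graphs and in trees *)

Section Distance.

Local Open Scope nat_scope.

Variables (T : finType) (e : rel T).

Lemma bigminn_le (I : eqType) (m : nat) (F : I -> nat) (P : pred I) s i :
  i \in s -> P i -> \big[minn/m]_(j <- s | P j) F j <= F i.
Proof.
elim: s => [//|a s IH]; rewrite in_cons big_cons => /orP[/eqP<- ->|/IH{}IH Pi].
  exact: geq_minl.
by case: ifP => _; rewrite ?geq_min IH ?orbT.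
Qed.

Lemma dist_le_path u p : path e u p -> dist e u (last u p) <= size p.
Proof.
move=> /shortenP[q eq_p uq sub_qp].
have ltq : size q < #|T|.
  by rewrite -[(size q).+1]/(size (u :: q)) -(card_uniqP uq) max_card.
(* The minimum in [dist] only ranges over lengths below [#|T|], so it is the
   simple path [q] extracted from [p] that bounds it. *)
apply: (@leq_trans (size q)); last first.
  by apply: uniq_leq_size => //; case/andP: uq.
apply: (@bigminn_le _ _ (fun k : 'I_#|T| => nat_of_ord k) _ _ (Ordinal ltq)).
  exact: mem_index_enum.
by apply/existsP; exists (in_tuple q); rewrite eq_p /=.
Qed.

Hypothesis e_conn : connected e.

Lemma dist_lt_card u v : dist e u v < #|T|.
Proof.
have [p ep ->] := connectP (e_conn u v).
case: (shortenP ep) => q eq_ /card_uniqP uq _.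
apply: leq_ltn_trans (dist_le_path eq_) _.
by rewrite -[(size q).+1]/(size (u :: q)) -uq max_card.
Qed.

Lemma dist_path u v :
  exists p, [/\ path e u p, last u p = v & size p = dist e u v].
Proof.
pose K d := d = #|T| \/ exists p, [/\ path e u p, last u p = v & size p = d].
suff: K (dist e u v).
  by case=> // dT; have := dist_lt_card u v; rewrite dT ltnn.
apply: big_ind => [|a b Ka Kb|i /existsP[w /andP[ew /eqP lw]]].
- by left.
- by rewrite /minn; case: ifP.
- by right; exists w; rewrite size_tuple.
Qed.

Lemma distnn u : dist e u u = 0.
Proof. by apply/eqP; rewrite -leqn0; apply: (@dist_le_path u [::]). Qed.

Lemma dist_eq0 u v : (dist e u v == 0) = (u == v).
Proof.
apply/eqP/eqP => [d0|->]; last exact: distnn.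
have [p [_ lp]] := dist_path u v.
by rewrite d0 => /size0nil p0; rewrite -lp p0.
Qed.

Lemma dist_triangle v u w : dist e u w <= dist e u v + dist e v w.
Proof.
have [p [ep lp <-]] := dist_path u v.
have [q [eq_ lq <-]] := dist_path v w.
rewrite -size_cat -lq -lp -last_cat dist_le_path // cat_path ep /=.
by rewrite lp.
Qed.

Hypothesis e_sym : symmetric e.

Lemma distC u v : dist e u v = dist e v u.
Proof.
suff le_d a b : dist e a b <= dist e b a.
  by apply/eqP; rewrite eqn_leq !le_d.
have [p [ep lp <-]] := dist_path b a.
have ep' : path e (last b p) (rev (belast b p)).
  by rewrite rev_path (eq_path (e' := e)) // => x y; rewrite e_sym.
have := dist_le_path ep'; rewrite size_rev size_belast lp.
suff -> : last a (rev (belast b p)) = b by [].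
by case: (p) lp => [//|c q] _ /=; rewrite rev_cons last_rcons.
Qed.

Lemma dist_edge u v : e u v -> dist e u v <= 1.
Proof.
by move=> euv; have := @dist_le_path u [:: v]; rewrite /= euv; apply.
Qed.

Lemma dist_edge_leS u w v : e u w -> dist e u v <= (dist e w v).+1.
Proof.
move=> /dist_edge d1; apply: leq_trans (dist_triangle w u v) _.
by rewrite -add1n leq_add2r.
Qed.

Lemma dist_step u v : u != v -> exists2 w, e u w & dist e u v = (dist e w v).+1.
Proof.
move=> neq; have [p [ep lp sp]] := dist_path u v.
case: p ep lp sp => [|w p] /=; first by move=> _ /eqP; rewrite (negbTE neq).
move=> /andP[euw ep] lp sp; exists w => //.
apply/eqP; rewrite eqn_leq dist_edge_leS //= -sp ltnS -lp.
exact: dist_le_path.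
Qed.

Hypothesis e_irr : irreflexive e.
Hypothesis e_acyc : acyclic e.

Definition avoiding u : rel T := fun a b => [&& e a b, a != u & b != u].

(** A path between two neighbours of [u] that avoids [u] closes up to a cycle
    through [u]. *)
Lemma acyclic_neighbour_unique u w1 w2 :
  e u w1 -> e u w2 -> connect (avoiding u) w1 w2 -> w1 = w2.
Proof.
move=> e1 e2 /connectP[p0 ep0 lp0].
case: (shortenP ep0) lp0 => p ep up _ lp.
case: p ep up lp => [//|a p] ep up lp.
have epe : path e w1 (a :: p).
  by apply: sub_path ep => x y /and3P[].
have nu : all (predC1 u) (a :: p).
  elim: (a :: p) (w1) ep {up lp epe e1} => [//|b s IH] c /= /andP[].
  by case/and3P=> _ _ nb /IH ->; rewrite andbT.
have := e_acyc (c := [:: u, w1, a & p]); suff: ucycle e [:: u, w1, a & p].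
  by move=> cu /(_ cu).
have lastu : e (last w1 (a :: p)) u by rewrite e_sym -lp.
have nu' : u \notin a :: p.
  by apply/negP => /(allP nu); rewrite /= eqxx.
have nu1 : u != w1 by apply/eqP => uw; move: e1; rewrite uw e_irr.
rewrite /ucycle /ucycleb cons_uniq up in_cons negb_or nu1 nu'.
rewrite -[cycle _ _]/(path e u (rcons (w1 :: a :: p) u)) rcons_path.
by rewrite -[path e u _]/(e u w1 && path e w1 (a :: p)) e1 epe lastu.
Qed.

(** All nodes after [w] on a shortest path from [w] to [v] are strictly closer
    to [v] than [w] is, so none of them is [u]. *)
Lemma connect_avoiding u w v :
  w != u -> dist e w v <= dist e u v -> connect (avoiding u) w v.
Proof.
move dw: (dist e w v) => k; rewrite -dw.
elim: k w dw => [|k IH] w dw neq le_d.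
  by move/eqP: dw; rewrite dist_eq0 => /eqP->; apply: connect0.
have [|a ewa da] := @dist_step w v.
  by apply/eqP => wv; move: dw; rewrite wv distnn.
move: da; rewrite dw => -[da].
have na : a != u.
  by apply/eqP => au; move: le_d; rewrite -au -da dw ltnn.
apply: (@connect_trans _ _ a); last by apply: IH => //; rewrite -da -ltnS -dw ltnW.
by apply: connect1; rewrite /avoiding ewa neq na.
Qed.

(** The metric characterisation of trees on which everything below rests: from
    [u] at most one edge does not lead away from [v].  By [dist_step] and
    [dist_edge_cases] it exists and leads closer to [v] when [u != v]. *)
Lemma tree_step_unique u v w1 w2 : e u w1 -> e u w2 ->
  dist e w1 v <= dist e u v -> dist e w2 v <= dist e u v -> w1 = w2.
Proof.
move=> e1 e2 d1 d2.
have ne w : e u w -> w != u by move=> eu; apply/eqP => wu; rewrite wu e_irr in eu.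
have c1 := connect_avoiding (ne _ e1) d1.
have c2 := connect_avoiding (ne _ e2) d2.
apply: acyclic_neighbour_unique e1 e2 (connect_trans c1 _).
rewrite sym_connect_sym // => a b.
by rewrite /avoiding e_sym; congr (_ && _); rewrite andbC.
Qed.

Lemma dist_edge_cases u w v : e u w ->
  dist e u v = (dist e w v).+1 \/ dist e w v = (dist e u v).+1.
Proof.
move=> euw; have [le_d|lt_d] := leqP (dist e w v) (dist e u v); last first.
  by right; apply/eqP; rewrite eqn_leq lt_d dist_edge_leS // e_sym.
have [uv|/dist_step[a eua da]] := eqVneq u v.
  move: le_d; rewrite uv distnn leqn0 dist_eq0 => /eqP wv.
  by move: euw; rewrite wv uv e_irr.
by left; rewrite da (tree_step_unique (v := v) eua euw) // da.
Qed.

End Distance.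

(** * Rooted trees: sides of an edge, apices of pairs *)

Section RootedTree.

Local Open Scope nat_scope.

Variables (T : finType) (e : rel T) (r : T).
Hypothesis e_tree : tree e.

Let e_sym : symmetric e. Proof. by case: e_tree => -[]. Qed.
Let e_irr : irreflexive e. Proof. by case: e_tree => -[]. Qed.
Let e_conn : connected e. Proof. by case: e_tree. Qed.
Let e_acyc : acyclic e. Proof. by case: e_tree. Qed.

Local Notation d := (dist e).
Local Notation lev := (level e r).
Local Notation child := (children e r).
Local Notation anc := (ancestor e r).

Lemma childP p v : reflect (e p v /\ lev v = (lev p).+1) (v \in child p).
Proof. by rewrite inE; apply: (iffP andP) => -[-> /eqP]. Qed.

Lemma level_le_dist u v : lev v <= lev u + d u v.
Proof. exact: dist_triangle. Qed.

Lemma root_of_level0 v : lev v = 0 -> v = r.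
Proof. by move/eqP; rewrite dist_eq0 // => /eqP. Qed.

Lemma edge_child u w : e u w -> w \in child u \/ u \in child w.
Proof.
move=> euw; case: (dist_edge_cases e_conn e_sym e_irr e_acyc r euw) => dr.
  by right; apply/childP; rewrite e_sym euw /level ![d r _]distC // dr.
by left; apply/childP; rewrite euw /level ![d r _]distC // dr.
Qed.

Lemma parent_unique p q v : v \in child p -> v \in child q -> p = q.
Proof.
move=> /childP[ep lp] /childP[eq_ lq].
have le_lev a : lev v = (lev a).+1 -> d a r <= d v r.
  by rewrite ![d _ r]distC // => lv; rewrite -!/(lev _) lv.
apply: (tree_step_unique (u := v) e_conn e_sym e_irr e_acyc _ _ (le_lev _ lp)
  (le_lev _ lq)); by rewrite e_sym.
Qed.

Lemma ancestor_level a v : anc a v -> lev v = lev a + d a v.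
Proof.
case/connectP=> p pp ->; apply/eqP; rewrite eqn_leq level_le_dist /=.
have [ep ->] : path e a p /\ lev (last a p) = lev a + size p.
  elim: p a pp => [|b p IH] a /=; first by rewrite addn0.
  by case/andP=> /childP[-> lb] /IH[-> ->]; rewrite lb addSnnS.
by rewrite leq_add2l dist_le_path.
Qed.

(** Removing the edge from [p] to its child [v] leaves the subtree of [v] on
    one side, which is therefore the set of nodes closer to [v] than to [p]. *)
Lemma ancestor_closer p v u : v \in child p -> anc v u = (d v u < d p u).
Proof.
move=> vp; apply/idP/idP => [/ancestor_level lu|].
  have := level_le_dist p u; case/childP: vp => _ lv.
  by rewrite lu lv addSnnS leq_add2l.
move dv: (d v u) => k; rewrite -dv.
elim: k v p vp dv => [|k IH] v p vp dv lt_d.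
  by move/eqP: dv; rewrite dist_eq0 // => /eqP->; apply: connect0.
have [|w evw dw] := dist_step e_conn (u := v) (v := u).
  by apply/eqP => vu; move: dv; rewrite vu distnn.
have [wv|vw] := edge_child evw.
  apply: (@connect_trans _ _ w); first exact: connect1.
  by apply: IH wv _ _; rewrite dw // in dv *; case: dv.
move: lt_d; rewrite (parent_unique vp vw).
by move: dw; rewrite dv => -[->]; rewrite ltnNge leqnSn.
Qed.

Lemma dist_child_below p v u : v \in child p -> anc v u -> d u p = (d u v).+1.
Proof.
move=> vp; rewrite (ancestor_closer u vp) ![d _ u]distC // => lt_d.
apply/eqP; rewrite eqn_leq lt_d andbT [d u p]distC // [d u v]distC //.
by apply: dist_edge_leS => //; case/childP: vp.
Qed.

Lemma dist_child_above p v u : v \in child p -> ~~ anc v u -> d u v = (d u p).+1.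
Proof.
move=> vp; have [evp _] := childP _ _ vp; rewrite (ancestor_closer u vp).
rewrite ![d u _]distC //.
by case: (dist_edge_cases e_conn e_sym e_irr e_acyc u evp) => -> //; rewrite leqnn.
Qed.

Lemma ancestor_top a v : anc a v -> v = a \/ exists2 w, w \in child a & anc w v.
Proof.
case/connectP=> -[|w p] /= pp ->; first by left.
by case/andP: pp => wa pw; right; exists w => //; apply/connectP; exists p.
Qed.

Lemma ancestor_bottom a v :
  anc a v -> v = a \/ exists2 p, anc a p & v \in child p.
Proof.
case/connectP=> p; case/lastP: p => [|p w] pp ->; first by left.
move: pp; rewrite rcons_path last_rcons => /andP[pp wl]; right.
by exists (last a p) => //; apply/connectP; exists p.
Qed.

Lemma ancestor_of_child p v u : v \in child p -> anc v u -> anc p u.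
Proof. by move=> vp; apply: connect_trans; apply: connect1. Qed.

(** The edge from [p] to [v] is a bridge, so every path from the subtree of [v]
    to a node outside it runs through [p]. *)
Lemma dist_across p v u x : v \in child p -> anc v u -> ~~ anc v x ->
  d u x = d u p + d p x.
Proof.
move dv: (d u v) => k; elim: k u p v dv => [|k IH] u p v dv vp vu vx.
  move/eqP: dv; rewrite dist_eq0 // => /eqP->.
  rewrite (dist_child_below vp (connect0 _ _)) distnn add1n.
  by rewrite [LHS]distC // (dist_child_above vp vx) distC.
have [uv|[w wv wu]] := ancestor_top vu.
  by move: dv; rewrite uv distnn.
have wx : ~~ anc w x by apply: contra vx; apply: ancestor_of_child.
have dw : d u w = k.
  by have := dist_child_below wv wu; rewrite dv => -[].
rewrite (IH _ _ _ dw wv wu wx) (dist_child_below vp vu) addSnnS.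
by rewrite [d v x]distC // (dist_child_above vp vx) [d x p]distC.
Qed.

Lemma ancestor_root u : anc r u.
Proof.
move lu: (lev u) => k; elim: k u lu => [|k IH] u lu.
  by rewrite (root_of_level0 lu); apply: connect0.
have [|w euw dw] := dist_step e_conn (u := u) (v := r).
  by apply/eqP => ur; move: lu; rewrite ur /level distnn.
have lw : lev u = (lev w).+1 by rewrite /level [LHS]distC // dw distC.
apply: (@connect_trans _ _ w); first by apply: IH; move: lw; rewrite lu => -[].
by apply: connect1; apply/childP; rewrite e_sym.
Qed.

(** The metric form of being the lowest common ancestor: [z] is the highest
    point of the path joining [x] and [y]. *)
Definition apex (z x y : T) : Prop :=
  [/\ anc z x, anc z y & d x y = d z x + d z y].

Lemma apexC z x y : apex z x y -> apex z y x.
Proof. by case=> zx zy dxy; split; rewrite // distC // addnC. Qed.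

Lemma apex_exists x y : exists z, apex z x y.
Proof.
suff apex_below k z : anc z x -> anc z y -> d z x = k -> exists z, apex z x y.
  by apply: (@apex_below (d r x) r); rewrite ?ancestor_root.
elim: k z => [|k IH] z zx zy dk.
  move/eqP: dk; rewrite dist_eq0 // => /eqP zx'; exists z.
  by split; rewrite // zx' distnn.
have [xz|[w wz wx]] := ancestor_top zx.
  by move: dk; rewrite xz distnn.
have [wy|wy] := boolP (anc w y).
  apply: (IH w) => //; have := dist_child_below wz wx.
  by rewrite [d x z]distC // dk [d x w]distC // => -[].
by exists z; split; rewrite // (dist_across wz wx wy) [d x z]distC.
Qed.

(** An apex survives moving one endpoint up, which reduces statements about
    [apex z x y] to [x = y = z]. *)
Lemma apex_parent z x y : apex z x y -> y != z ->
  exists p, [/\ y \in child p, ~~ anc y x, apex z x p & d z y = (d z p).+1].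
Proof.
case=> zx zy dxy yz.
have [zy'|[p zp yp]] := ancestor_bottom zy; first by rewrite zy' eqxx in yz.
have nyx : ~~ anc y x.
  apply/negP => yx; move/eqP: yz; apply; apply/esym/eqP.
  rewrite -(dist_eq0 e_conn); have := ancestor_level yx.
  have := ancestor_level zx; have := ancestor_level zy.
  by move: dxy; rewrite [d x y]distC //; lia.
have dzy : d z y = (d z p).+1.
  have := ancestor_level zp; have := ancestor_level zy.
  by case/childP: yp => _ ->; lia.
exists p; split=> //; split=> //.
by have := dist_child_above yp nyx; rewrite dxy dzy; lia.
Qed.

Lemma apex_root_lca x y :
  apex r x y <-> lowest_common_ancestor e r r x y.
Proof.
split=> [[rx ry dxy]|[rx ry low]].
  split=> // b bx by_; have := dist_triangle e_conn b x y.
  rewrite dxy [d x b]distC // -!/(lev _).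
  rewrite (ancestor_level bx) (ancestor_level by_) /level distnn; lia.
have [z zxy] := apex_exists x y; case: (zxy) => zx zy _.
have := low z zx zy; rewrite {2}/level distnn leqn0 => /eqP /root_of_level0 zr.
by rewrite -zr.
Qed.

Lemma ancestor_child_unique v w1 w2 u :
  w1 \in child v -> w2 \in child v -> anc w1 u -> anc w2 u -> w1 = w2.
Proof.
move=> wv1 wv2; rewrite (ancestor_closer _ wv1) (ancestor_closer _ wv2).
case/childP: wv1 wv2 => e1 _ /childP[e2 _] lt1 lt2.
by apply: (tree_step_unique (v := u) e_conn e_sym e_irr e_acyc e1 e2); apply: ltnW.
Qed.

(** The subtrees of the children are disjoint, by [ancestor_child_unique], and
    cover all proper descendants. *)
Lemma sum_subtree (F : T -> nat) v :
  \sum_(u | anc v u) F u = F v + \sum_(w in child v) \sum_(u | anc w u) F u.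
Proof.
rewrite (bigD1 v) /=; last exact: connect0.
congr (_ + _).
(* Proper descendants are classified by the child through which they pass. *)
pose next u := odflt v [pick w in child v | anc w u].
rewrite (partition_big next (mem (child v))) /=; last first.
  move=> u /andP[/ancestor_top[->|[w wv wu] _]]; first by rewrite eqxx.
  rewrite /next; case: pickP => [b /andP[]//|/(_ w)].
  by rewrite /= wv wu.
apply: eq_bigr => w wv; apply: eq_bigl => u; apply/idP/idP.
  case/andP=> /andP[vu uv] /eqP <-; rewrite /next; case: pickP => [b /andP[]//|/=].
  have [vu'|[b bv bu] /(_ b)] := ancestor_top vu; last by rewrite bv bu.
  by rewrite vu' eqxx in uv.
move=> wu; rewrite (ancestor_of_child wv wu) /=; apply/andP; split.
  apply/eqP => uv; have := ancestor_level wu; rewrite uv.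
  by case/childP: wv => _ ->; lia.
rewrite /next; case: pickP => [b /andP[bv bu]|/(_ w)] /=; last by rewrite wv wu.
by apply/eqP; apply: ancestor_child_unique bv wv bu wu.
Qed.

End RootedTree.

(** * Perfect binary trees *)

Section PerfectTree.

Local Open Scope nat_scope.

Variables (T : finType) (e : rel T) (r : T) (h : nat).
Hypothesis hT : perfect_binary_tree e r h.

Let e_tree : tree e. Proof. by case: hT. Qed.
Let e_conn : connected e. Proof. by case: e_tree. Qed.
Let e_sym : symmetric e. Proof. by case: e_tree => -[]. Qed.

Local Notation d := (dist e).
Local Notation lev := (level e r).
Local Notation child := (children e r).
Local Notation anc := (ancestor e r).

(** Levels are bounded, so from any node a descent through children ends in a
    leaf, which lies at level [h]. *)
Lemma level_le_height v : lev v <= h.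
Proof.
move dv: (#|T| - lev v) => k; elim: k v dv => [|k IH] v dv.
  by have := dist_lt_card e_conn r v; rewrite -subn_gt0 -/(lev v) dv ltnn.
case: hT => _ card2 leafh; have [/leafh-> //|nl] := boolP (leaf e r v).
have /card_gt0P[w wv] : 0 < #|child v| by rewrite card2.
have [_ lw] := childP _ _ _ _ wv.
by apply: leq_trans (IH w _); rewrite ?lw //; lia.
Qed.

Lemma card_child v : lev v < h -> #|child v| = 2.
Proof.
case: hT => _ card2 leafh lt_h; apply: card2.
by apply/negP => /leafh lv; rewrite lv ltnn in lt_h.
Qed.

Lemma child_height v : lev v = h -> child v = set0.
Proof.
move=> lv; apply/setP => w; rewrite in_set0; apply/negP => /childP[_ lw].
by have := level_le_height w; rewrite lw lv ltnn.
Qed.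

(** [k] is the height of the subtree of [v]; counting one node more than the
    subtree has avoids a truncated subtraction. *)
Lemma card_subtree v k : lev v + k = h -> (\sum_(u | anc v u) 1).+1 = 2 ^ k.+1.
Proof.
elim: k v => [|k IH] v lv; rewrite (sum_subtree r e_tree).
  by rewrite child_height ?big_set0 // -lv addn0.
have cS w : w \in child v -> \sum_(u | anc w u) 1 = (2 ^ k.+1).-1.
  by case/childP=> _ lw; rewrite -(IH w) // lw addSnnS.
rewrite (eq_bigr _ cS) sum_nat_const card_child; last by lia.
by have := expn_gt0 2 k.+1; rewrite [2 ^ k.+2]expnS; lia.
Qed.

Lemma sum_dist_subtree v k : lev v + k = h ->
  \sum_(u | anc v u) d v u + 2 ^ k.+1 = k * 2 ^ k.+1 + 2.
Proof.
elim: k v => [|k IH] v lv; rewrite (sum_subtree r e_tree) distnn.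
  by rewrite child_height ?big_set0 // -lv addn0.
have cS w : w \in child v ->
    \sum_(u | anc w u) d v u = (2 ^ k.+1).-1 + (k * 2 ^ k.+1 + 2 - 2 ^ k.+1).
  move=> wv; have lw : lev w + k = h by case/childP: wv => _ ->; lia.
  rewrite (eq_bigr (fun u => 1 + d w u)); last first.
    move=> u wu; have := dist_child_below e_tree wv wu.
    by rewrite ![d u _]distC // add1n.
  rewrite big_split /=; have := card_subtree lw; have := IH w lw.
  move: (\sum_(u | anc w u) 1) => a; move: (\sum_(u | anc w u) d w u) => b.
  by lia.
rewrite (eq_bigr _ cS) sum_nat_const card_child; last by lia.
have := IH; have [w wv] : exists w, w \in child v.
  by apply/card_gt0P; rewrite card_child //; lia.
have lw : lev w + k = h by case/childP: wv => _ ->; lia.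
move/(_ w lw); move: (\sum_(u | anc w u) d w u) => b.
by have := expn_gt0 2 k.+1; rewrite [2 ^ k.+2]expnS; nia.
Qed.

Lemma card_tree : #|T|.+1 = 2 ^ h.+1.
Proof.
rewrite -(@card_subtree r h) /level ?distnn // sum1_card.
by congr _.+1; apply: eq_card => u; rewrite [RHS](ancestor_root r e_tree).
Qed.

Lemma sum_level : \sum_u d r u + 2 ^ h.+1 = h * 2 ^ h.+1 + 2.
Proof.
rewrite -(@sum_dist_subtree r h) /level ?distnn //; congr (_ + _).
by apply: eq_bigl => u; rewrite (ancestor_root r e_tree).
Qed.

End PerfectTree.

(** * Coherence through a Green function *)

Section Coherence.

Variables (R : realType) (T : finType) (e : rel T).

Local Notation d u v := ((dist e u v)%:R : R).

(** The Laplacian acting on functions. *)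
Definition lap (f : T -> R) (u : T) : R := \sum_(w | e u w) (f u - f w).

(** A function that vanishes on the leaders and whose Laplacian is the identity
    on the followers restricts to the inverse of the follower block, because the
    columns dropped from the Laplacian meet only zeros. *)
Lemma R_NF_green (S : {set T}) (G : T -> T -> R) : irreflexive e ->
  (forall w v, w \in S -> G w v = 0) ->
  (forall u v, u \notin S -> lap (G^~ v) u = (u == v)%:R) ->
  R_NF e R S = (\sum_u G u u) / 2.
Proof.
move=> e_irr GS lapG; rewrite /R_NF; congr (_ / 2).
pose B : 'M[R]_#|~: S| := \matrix_(i, j) G (enum_val i) (enum_val j).
have sum_followers (F : T -> R) : (forall w, w \in S -> F w = 0) ->
    \sum_(k < #|~: S|) F (enum_val k) = \sum_w F w.
  move=> FS; rewrite -(big_enum_val (A := mem (~: S)) F) [RHS](bigID (mem (~: S))) /=.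
  by rewrite [X in _ + X]big1 ?addr0 // => w; rewrite in_setC negbK => /FS.
have AB : laplacian_ff e R S *m B = 1%:M.
  apply/matrixP => i j; rewrite !mxE.
  set u := enum_val i; set v := enum_val j.
  have uS : u \notin S by have := enum_valP i; rewrite in_setC.
  have -> : (i == j) = (u == v) by rewrite (inj_eq enum_val_inj).
  rewrite -(lapG u v uS).
  pose F w := (#|[set w | e u w]|%:R *+ (u == w) - (e u w)%:R) * G w v.
  transitivity (\sum_(k < #|~: S|) F (enum_val k)).
    apply: eq_bigr => k _; rewrite !mxE /follower_index !enum_rankK.
    by rewrite (inj_eq enum_rank_inj).
  rewrite sum_followers; last by move=> w wS; rewrite /F GS // mulr0.
  rewrite /F /lap sumrB; under eq_bigr do rewrite mulrBl.
  rewrite sumrB; congr (_ - _).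
    rewrite (bigD1 u) //= eqxx mulr1n big1 ?addr0; last first.
      by move=> w; rewrite eq_sym => /negbTE ->; rewrite mulr0n mul0r.
    rewrite sumr_const mulr_natl; congr (_ *+ _).
    by apply: eq_card => w; rewrite inE.
  rewrite [RHS]big_mkcond /=; apply: eq_bigr => w _.
  by case: (e u w); rewrite ?mul1r ?mul0r.
have [uA _] := mulmx1_unit AB.
have -> : invmx (laplacian_ff e R S) = B by rewrite -(mulKmx uA B) AB mulmx1.
rewrite -[RHS](sum_followers (fun u => G u u)); last by move=> w /GS.
by apply: eq_bigr => i _; rewrite mxE.
Qed.

Hypothesis e_tree : tree e.

Let e_sym : symmetric e. Proof. by case: e_tree => -[]. Qed.
Let e_irr : irreflexive e. Proof. by case: e_tree => -[]. Qed.
Let e_conn : connected e. Proof. by case: e_tree. Qed.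
Let e_acyc : acyclic e. Proof. by case: e_tree. Qed.

(** Among the edges at [u], one leads towards [v] and the others away from it,
    except that all lead away when [u = v]. *)
Lemma lap_dist u v :
  lap (fun w => d w v) u = 2 - #|[set w | e u w]|%:R - 2 * (u == v)%:R.
Proof.
have degE : \sum_(w | e u w) (1 : R) = #|[set w | e u w]|%:R.
  by rewrite sumr_const; congr (_ *+ _); apply: eq_card => w; rewrite inE.
have step := dist_edge_cases e_conn e_sym e_irr e_acyc.
have [<-|uv] := eqVneq u v.
  rewrite /lap distnn mulr0n mulr1n -[in RHS]degE.
  suff -> : \sum_(w | e u w) (0 - d w u) = - \sum_(w | e u w) 1 by ring.
  rewrite -sumrN; apply: eq_bigr => w euw.
  by have [|->] := step u w u euw; rewrite distnn // sub0r.
have [c euc dc] := dist_step e_conn uv.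
rewrite /lap -degE (bigD1 c euc) [in RHS](bigD1 c euc) /=.
rewrite (eq_bigr (fun=> - 1 : R)) => [|w /andP[euw wc]]; last first.
  have [dw|->] := step u w v euw; last by rewrite -[X in _ - X]natr1; ring.
  case/eqP: wc.
  by apply: (tree_step_unique e_conn e_sym e_irr e_acyc euw euc (v := v));
    rewrite ?dw ?dc ?leqnSn // -dw dc.
by rewrite sumrN dc -natr1 mulr0; ring.
Qed.

Lemma lapD f g u : lap (fun w => f w + g w) u = lap f u + lap g u.
Proof. by rewrite /lap -big_split; apply: eq_bigr => w _ /=; ring. Qed.

Lemma lapZ a f u : lap (fun w => a * f w) u = a * lap f u.
Proof. by rewrite /lap mulr_sumr; apply: eq_bigr => w _; ring. Qed.

Lemma lap_const a u : lap (fun=> a) u = 0.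
Proof. by rewrite /lap big1 // => w _; rewrite subrr. Qed.

(** The Gromov product of [u] and [v] based at [x]: the length of the common
    part of the paths from [x] to [u] and to [v].  It is the Green function of
    the tree grounded at [x]. *)
Definition gromov x u v : R := (d u x + d v x - d u v) / 2.

Lemma lap_gromov x u v :
  lap (fun w => gromov x w v) u = (u == v)%:R - (u == x)%:R.
Proof.
rewrite /lap /gromov; transitivity (2^-1 * (lap (fun w => d w x) u
  + lap (fun=> d v x) u + (-1) * lap (fun w => d w v) u)).
  by rewrite -lapZ -!lapD -lapZ; apply: eq_bigr => w _; field.
by rewrite lap_const !lap_dist; field.
Qed.

Lemma gromov0 x v : gromov x x v = 0.
Proof.
rewrite /gromov distnn [dist e v x]distC // add0r subrr mul0r //.
Qed.

Lemma R_NF1 x : R_NF e R [set x] = (\sum_u d u x) / 2.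
Proof.
rewrite (R_NF_green (G := gromov x) e_irr).
- congr (_ / 2); apply: eq_bigr => u _.
  by rewrite /gromov distnn; field.
- by move=> w v /set1P ->; apply: gromov0.
- by move=> u v; rewrite in_set1 lap_gromov => /negbTE ->; rewrite subr0.
Qed.

(** Grounding a second node [y] subtracts from the Green function grounded at
    [x] the rank-one term that cancels it at [y]. *)
Lemma R_NF2 x y : x != y ->
  R_NF e R [set x; y] = (\sum_u (d u x - gromov x u y ^+ 2 / d x y)) / 2.
Proof.
move=> xy; have d0 : d x y != 0 by rewrite pnatr_eq0 dist_eq0.
have gyy : gromov x y y = d x y.
  by rewrite /gromov distnn [dist e y x]distC //; field.
pose G u v := gromov x u v + (- gromov x v y / d x y) * gromov x u y.
rewrite (R_NF_green (G := G) e_irr).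
- congr (_ / 2); apply: eq_bigr => u _; rewrite /G {1}/gromov distnn.
  by field.
- move=> w v /set2P[] ->; rewrite /G ?gromov0 ?mulr0 ?addr0 // gyy.
  by rewrite divfK // /gromov [dist e y v]distC //; ring.
- move=> u v; rewrite in_set2 negb_or => /andP[/negbTE ux /negbTE uy].
  by rewrite /G lapD lapZ !lap_gromov ux uy mulr0n; ring.
Qed.

(** In terms of the distances [p] and [q] from [u] to the leaders and their
    mutual distance [d], the resistance between [u] and the two joined leaders
    is (p + q) / 2 - d / 4 - (p - q)^2 / (4 d).  Summing over [u] leaves two
    kinds of sums to compute. *)
Definition distsum x : R := \sum_u d u x.

Definition sqdiffsum x y : R := \sum_u (d u x - d u y) ^+ 2.

Lemma R_NF2_sums x y : x != y ->
  R_NF e R [set x; y] = ((distsum x + distsum y) / 2 - #|T|%:R * d x y / 4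
                         - sqdiffsum x y / (4 * d x y)) / 2.
Proof.
move=> xy; have d0 : d x y != 0 by rewrite pnatr_eq0 dist_eq0.
rewrite R_NF2 //; congr (_ / 2).
transitivity (\sum_u ((d u x + d u y) / 2 - d x y / 4
                      - (d u x - d u y) ^+ 2 / (4 * d x y))).
  apply: eq_bigr => u _; rewrite /gromov [dist e y x]distC //; field.
  exact: d0.
rewrite !sumrB -!mulr_suml big_split /= sumr_const.
by rewrite -[_ *+ #|xpredT|]mulr_natl.
Qed.

(** The summand subtracted in [R_NF2] is a square over a positive number, and
    at [u = y] it equals the distance from [x] to [y]. *)
Lemma R_NF_second_leader x y : x != y -> R_NF e R [set x; y] < R_NF e R [set x].
Proof.
move=> xy; have d0 : 0 < d x y by rewrite ltr0n lt0n dist_eq0.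
rewrite R_NF1 R_NF2 // ltr_pM2r ?invr_gt0 ?ltr0n // sumrB ltrBlDl ltrDr.
rewrite (bigD1 y) //= ltr_pwDl //; last first.
  by apply: sumr_ge0 => u _; rewrite divr_ge0 ?sqr_ge0 ?ltW.
rewrite /gromov distnn [dist e y x]distC //.
by rewrite divr_gt0 // exprn_gt0 //; lra.
Qed.

End Coherence.

(** * Closed forms in a perfect binary tree *)

Section ClosedForms.

Variables (R : realType) (T : finType) (e : rel T) (r : T) (h : nat).
Hypothesis hT : perfect_binary_tree e r h.

Let e_tree : tree e. Proof. by case: hT. Qed.
Let e_conn : connected e. Proof. by case: e_tree. Qed.
Let e_sym : symmetric e. Proof. by case: e_tree => -[]. Qed.

Local Notation d u v := ((dist e u v)%:R : R).
Local Notation lev := (level e r).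
Local Notation child := (children e r).
Local Notation anc := (ancestor e r).
Local Notation N := (2 ^+ h.+1 : R).

Lemma natr_card_tree : #|T|%:R = N - 1.
Proof. by rewrite -natrX -(card_tree hT) -natr1 addrK. Qed.

Lemma natr_card_subtree v : \sum_(u | anc v u) 1 = N * 2 ^- lev v - 1.
Proof.
have lv : (lev v + (h - lev v) = h)%N by rewrite subnKC // (level_le_height hT).
apply: (addIr 1); rewrite subrK -{1}lv -addnS exprD mulrAC divff ?mul1r; last first.
  by rewrite expf_neq0 // pnatr_eq0.
by rewrite -natrX -(card_subtree hT lv) -natr1 natr_sum.
Qed.

Lemma dist_child_diff p v u : v \in child p ->
  d u v = d u p + 1 - 2 * (anc v u)%:R.
Proof.
move=> vp; have [vu|vu] := boolP (anc v u).
  by rewrite (dist_child_below e_tree vp vu) -natr1 mulr1n; ring.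
by rewrite (dist_child_above e_tree vp vu) -natr1 mulr0n; ring.
Qed.

Lemma sum_anc (F : T -> R) v :
  \sum_u (anc v u)%:R * F u = \sum_(u | anc v u) F u.
Proof.
rewrite [RHS]big_mkcond /=; apply: eq_bigr => u _.
by case: (anc v u); rewrite ?mul1r ?mul0r.
Qed.

Lemma distsum_child p v : v \in child p ->
  distsum R e v = distsum R e p + #|T|%:R - 2 * \sum_(u | anc v u) 1.
Proof.
move=> vp; rewrite /distsum (eq_bigr _ (fun u _ => dist_child_diff u vp)).
rewrite sumrB big_split /= sumr_const -mulr_sumr; congr (_ - 2 * _).
by rewrite -sum_anc; apply: eq_bigr => u _; rewrite mulr1.
Qed.

(** Moving [v] down from [p] shifts the distances by one, in a direction that
    depends on the side of the edge; below the edge, the old difference of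
    distances is constant because every path to [x] runs through [p]. *)
Lemma sqdiffsum_child p v x : v \in child p -> ~~ anc v x ->
  sqdiffsum R e x v = sqdiffsum R e x p - 2 * (distsum R e x - distsum R e p)
    + 4 * (\sum_(u | anc v u) 1) * d p x + #|T|%:R.
Proof.
move=> vp vx; rewrite /sqdiffsum /distsum.
rewrite (eq_bigr (fun u => (d u x - d u p) ^+ 2 - 2 * (d u x - d u p)
   + (anc v u)%:R * (4 * d p x) + 1)) => [|u _]; last first.
  rewrite (dist_child_diff u vp); have [vu|_] := boolP (anc v u).
    by rewrite (dist_across e_tree vp vu vx) natrD mulr1n; ring.
  by rewrite mulr0n; ring.
rewrite !big_split /= sumr_const sum_anc; congr (_ + _ + _ + _).
  by rewrite sumrN -mulr_sumr -sumrB.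
rewrite -mulrA mulrCA mulr_suml.
by apply: eq_bigr => u _; rewrite mul1r.
Qed.

Lemma distsum_root : distsum R e r = N * (h%:R - 1) + 2.
Proof.
rewrite /distsum (eq_bigr (fun u => d r u)) => [|u _]; last by rewrite distC.
have := congr1 (fun k => k%:R : R) (sum_level hT).
rewrite /= natrD [RHS]natrD natrM natrX natr_sum => sum_lev.
by apply: (addIr N); rewrite sum_lev; ring.
Qed.

Lemma distsum_level v : distsum R e v =
  N * (h%:R - 3) + 2 + (N + 1) * (lev v)%:R + 2 * (N * 2 ^- lev v).
Proof.
move lv: (lev v) => k; elim: k v lv => [|k IH] v lv.
  by rewrite (root_of_level0 e_tree lv) distsum_root expr0 invr1; ring.
have [vr|[p _ vp]] := ancestor_bottom (ancestor_root r e_tree v).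
  by move: lv; rewrite vr /level distnn.
have [_ lvp] := childP _ _ _ _ vp; have lp : lev p = k by rewrite lv in lvp; case: lvp.
rewrite (distsum_child vp) (IH p lp) natr_card_tree natr_card_subtree lv.
by rewrite [2 ^+ k.+1]exprS -[k.+1%:R]natr1; field; rewrite expf_neq0 ?pnatr_eq0.
Qed.

Lemma sqdiffsumC x y : sqdiffsum R e x y = sqdiffsum R e y x.
Proof. by apply: eq_bigr => u _; rewrite -sqrrN opprB. Qed.

(** The solution of the recursion [sqdiffsum_child].  With two endpoints to
    move, it is found by summing (2 j - 1) times the number of nodes beyond the
    j-th edge of the path from [x] to [y]; it depends only on the level of the
    apex and on the depths below it. *)
Definition sqdiff_closed z x y : R :=
  let M := N * 2 ^- lev z in let A := d z x in let B := d z y in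
  let s := 2 ^- dist e z x + 2 ^- dist e z y in
  (N - 1) * (A + B) ^+ 2 - 4 * (N + 1) * A * B + 12 * M * (2 - s)
  - 4 * (A + B) * M * s.

Lemma sqdiff_closed_child z x p y : y \in child p -> ~~ anc y x ->
  apex e r z x p -> dist e z y = (dist e z p).+1 ->
  sqdiffsum R e x p = sqdiff_closed z x p ->
  sqdiffsum R e x y = sqdiff_closed z x y.
Proof.
move=> yp nyx [zx zp dxp] dzy IH.
have [_ ly] := childP _ _ _ _ yp.
have lx := ancestor_level e_tree zx; have lp := ancestor_level e_tree zp.
rewrite (sqdiffsum_child yp nyx) IH !distsum_level natr_card_subtree.
rewrite natr_card_tree /sqdiff_closed dzy ly lx lp [dist e p x]distC // dxp.
rewrite !natrD -[(dist e z p).+1%:R]natr1 !exprS !exprD.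
move: (dist e z x) (dist e z p) (lev z) => a b c.
by field; rewrite !expf_neq0 //= pnatr_eq0.
Qed.

Lemma sqdiffsum_closed z x y : apex e r z x y ->
  sqdiffsum R e x y = sqdiff_closed z x y.
Proof.
move dk: (dist e x y) => k; elim: k x y dk => [|k IH] x y dk zxy.
  move/eqP: dk; rewrite dist_eq0 // => /eqP xy; move: zxy; rewrite -xy => -[_ _].
  rewrite distnn => /esym/eqP; rewrite addn_eq0 andbb => /eqP dzx.
  rewrite /sqdiff_closed dzx /sqdiffsum big1 => [|u _]; last by rewrite subrr expr0n.
  by rewrite expr0 invr1; ring.
have step a b : dist e a b = k.+1 -> apex e r z a b -> b != z ->
    sqdiffsum R e a b = sqdiff_closed z a b.
  move=> dab zab bz; have [p [bp nba zap dzb]] := apex_parent e_tree zab bz.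
  apply: (sqdiff_closed_child bp nba zap dzb); apply: IH => //.
  by apply/eq_add_S; rewrite -dab (dist_child_above e_tree bp nba).
have [yz|/(step x y dk zxy)//] := eqVneq y z.
rewrite sqdiffsumC (step y x); first by rewrite /sqdiff_closed; ring.
- by rewrite distC.
- exact: apexC.
- by apply/eqP => xz; move: dk; rewrite xz yz distnn.
Qed.

(** Let [n] be one more than the number of nodes of a perfect binary tree.  For
    leaders at depths [a] and [b] below their lowest common ancestor, itself at
    level [c], this is the excess of twice their coherence over twice the
    coherence of the shape c = 0, a = b = 2.  The height enters both values
    through [n] and through one common term, which cancels. *)
Definition excess (n : R) (c a b : nat) : R :=
  let A := a%:R in let B := b%:R in let s := 2 ^- a + 2 ^- b in
  (n + 1) * (c%:R + A * B / (A + B)) + (A + B)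
  + n * 2 ^- c * (2 * s - 3 * (2 - s) / (A + B)) - (7 / 8 * n + 5).

Lemma R_NF2_excess z x y : x != y -> apex e r z x y ->
  R_NF e R [set x; y] = (N * (h%:R - 17 / 8) + 7) / 2
    + excess N (lev z) (dist e z x) (dist e z y) / 2.
Proof.
move=> xy zxy; have [zx zy dxy] := zxy.
have d0 : d z x + d z y != 0 by rewrite -natrD -dxy pnatr_eq0 dist_eq0.
rewrite R_NF2_sums // (sqdiffsum_closed zxy) natr_card_tree !distsum_level.
rewrite (ancestor_level e_tree zx) (ancestor_level e_tree zy).
rewrite /excess /sqdiff_closed dxy !natrD !exprD.
move: (dist e z x) (dist e z y) (lev z) d0 => a b c d0.
by field; rewrite !expf_neq0 ?pnatr_eq0 // d0.
Qed.

End ClosedForms.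

(** * Minimising over the shape of the pair *)

Section Excess.

Variable R : realType.
Implicit Types (n : R) (a b c : nat).

Lemma excessC n c a b : excess n c a b = excess n c b a.
Proof.
by rewrite /excess [2 ^- a + _]addrC [a%:R + _]addrC [a%:R * _]mulrC.
Qed.

Lemma excess_opt n : excess n 0 2 2 = 0.
Proof. by rewrite /excess; field. Qed.

(** A tie when [n = 32], that is in height 4. *)
Lemma excess_12 n : excess n 0 1 2 = (n - 32) / 24.
Proof. by rewrite /excess; field. Qed.

(** The same sign condition with the denominator [A + B] cleared. *)
Lemma excess_gt0 n c a b : (0 < a + b)%N ->
  let A := a%:R in let B := b%:R in let s := 2 ^- a + 2 ^- b in
  0 < (n + 1) * (c%:R * (A + B) + A * B) + (A + B) ^+ 2
      + n * 2 ^- c * (2 * s * (A + B) - 3 * (2 - s)) - (7 / 8 * n + 5) * (A + B) ->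
  0 < excess n c a b.
Proof.
move=> ab A B s pos; have d0 : 0 < A + B by rewrite -natrD ltr0n.
rewrite -(pmulr_lgt0 _ d0); apply: lt_le_trans pos _.
rewrite le_eqVlt; apply/orP; left; apply/eqP; rewrite /excess -/A -/B -/s.
by field; rewrite expf_neq0 ?pnatr_eq0 // gt_eqF.
Qed.

Lemma pow2V_bounds k : 0 < (2 ^- k : R) <= 1.
Proof. have pos : 0 < 2 ^+ k :> R by rewrite exprn_gt0.
by rewrite invr_gt0 pos invf_le1 //= exprn_ege1 // (ler1n R 2).
Qed.

(** More than half of the nodes then lie outside the branch of the root that
    contains both leaders, and the term (n + 1) c, the cost of reaching that
    branch, outweighs the rest. *)
Lemma excess_below_root n c a b : 32 <= n -> (0 < c)%N -> (0 < a + b)%N ->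
  (a <= b)%N -> 0 < excess n c a b.
Proof.
move=> n32 c0 ab le_ab; apply: excess_gt0 => //.
have c1 : 1 <= c%:R :> R by rewrite ler1n.
have D1 : 1 <= a%:R + b%:R :> R by rewrite -natrD ler1n.
have [m0 m1] : 0 < n * 2 ^- c /\ n * 2 ^- c <= n / 2.
  have n0 : 0 < n by lra.
  split; first by rewrite mulr_gt0 // invr_gt0 exprn_gt0.
  rewrite ler_pM2l // lef_pV2 ?posrE ?exprn_gt0 //.
  by rewrite -{1}[2]expr1 ler_weXn2l // ler1n.
move: (n * 2 ^- c) m0 m1 => m m0 m1.
have [p0 p1] := andP (pow2V_bounds a); have [q0 q1] := andP (pow2V_bounds b).
have A0 : 0 <= a%:R :> R by []; have B0 : 0 <= b%:R :> R by [].
have cD : a%:R + b%:R <= c%:R * (a%:R + b%:R) :> R by nra.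
case: a => [|[|a]] in ab le_ab D1 A0 cD p0 p1 *.
(* At depth 0 or 1 the coefficient of the subtree size [m] is nonnegative. *)
- have pos : 0 <= 2 * (2 ^- 0 + 2 ^- b) * (0%:R + b%:R) - 3 * (2 - (2 ^- 0 + 2 ^- b)) :> R.
    case: b ab {le_ab D1 B0 cD q1} q0 => [|[|b]] // _ q0; rewrite expr0 invr1.
      by rewrite expr1; lra.
    have : 2 <= b.+2%:R :> R by rewrite ler_nat.
    by nra.
  have := mulr_ge0 (ltW m0) pos; nra.
- have pos : 0 <= 2 * (2 ^- 1 + 2 ^- b) * (1%:R + b%:R) - 3 * (2 - (2 ^- 1 + 2 ^- b)) :> R.
    case: b le_ab {D1 B0 cD ab q1} q0 => [|[|[|b]]] // _ q0; rewrite expr1.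
      by lra.
      by rewrite expr2 invfM; lra.
    case: b q0 => [|b] q0; first by rewrite !exprS expr0 !invfM; lra.
    have : 4 <= b.+4%:R :> R by rewrite ler_nat.
    by nra.
  have := mulr_ge0 (ltW m0) pos; nra.
(* Otherwise it may be negative, but then A B >= A + B, so that the first term
   is at least 2 (n + 1) (A + B). *)
have A2 : 2 <= a.+2%:R :> R by rewrite ler_nat.
have B2 : 2 <= b%:R :> R by rewrite ler_nat (leq_trans _ le_ab).
move: (2 ^- a.+2) (2 ^- b) (a.+2%:R) (b%:R) p0 p1 q0 q1 A2 B2 cD
  => p q A B p0 p1 q0 q1 A2 B2 cD.
have AB : A + B <= A * B by nra.
have : - 6 * m <= m * (2 * (p + q) * (A + B) - 3 * (2 - (p + q))).
  by rewrite [- 6 * m]mulrC ler_pM2l //; nra.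
have : (n + 1) * (2 * (A + B)) <= (n + 1) * (c%:R * (A + B) + A * B).
  by rewrite ler_pM2l; lra.
by nra.
Qed.

(** The remaining shapes split into finitely many, settled by evaluation, and
    those with a depth of at least 4, where the powers of 1/2 may be dropped. *)
Lemma excess_at_root n a b : 32 <= n -> (0 < a + b)%N -> (a <= b)%N ->
  (a, b) != (1, 2)%N -> (a, b) != (2, 2)%N -> 0 < excess n 0 a b.
Proof.
move=> n32 ab le_ab n12 n22.
have half k : 2 ^- k.+1 = 2 ^- k / 2 :> R by rewrite exprS invfM mulrC.
have q0 k : 0 < 2 ^- k :> R by case/andP: (pow2V_bounds k).
have npos : 0 < n by lra.
have B4 k : 4 <= k.+4%:R :> R by rewrite ler_nat.
case: a b => [|[|[|[|a]]]] [|[|[|[|b]]]] // in ab le_ab n12 n22 *;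
  apply: excess_gt0 => //; rewrite ?half expr0 invr1.
all: try by lra.
all: have := B4 b; have := q0 b; move: (2 ^- b) (b.+4%:R) => q B qpos B4b.
(* After expansion the inequalities are linear in the products below. *)
all: have nq := mulr_gt0 npos qpos; have nqB : 0 < n * q * B by apply: mulr_gt0; lra.
all: have nB : 0 <= (n - 32) * (B - 4) by apply: mulr_ge0; lra.
all: have BB : 0 <= (B - 4) * (B - 4) by apply: mulr_ge0; lra.
all: try by lra.
have := B4 a; have := q0 a; move: (2 ^- a) (a.+4%:R) => p A ppos A4a.
have np := mulr_gt0 npos ppos; have npA : 0 < n * p * A by apply: mulr_gt0; lra.
have npB : 0 < n * p * B by apply: mulr_gt0; lra.
have nqA : 0 < n * q * A by apply: mulr_gt0; lra.
have nA : 0 <= (n - 32) * (A - 4) by apply: mulr_ge0; lra.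
have AA : 0 <= (A - 4) * (A - 4) by apply: mulr_ge0; lra.
have AB : 0 <= (A - 4) * (B - 4) by apply: mulr_ge0; lra.
have nAB : 0 <= n * ((A - 4) * (B - 4)) by apply: mulr_ge0; lra.
by lra.
Qed.

Lemma excess_trichotomy n c a b : 32 <= n -> (0 < a + b)%N ->
  [\/ 0 < excess n c a b,
      excess n c a b = (n - 32) / 24
    | excess n c a b = 0 /\ [/\ c = 0, a = 2 & b = 2]%N].
Proof.
move=> n32; wlog le_ab : a b / (a <= b)%N.
  move=> wl ab; have [/wl|/ltnW/wl] := leqP a b; first exact.
  by rewrite addnC excessC => /(_ ab)[]; [constructor 1|constructor 2|];
    move=> // [-> [-> -> ->]]; constructor 3.
move=> ab; case: c => [|c]; last by constructor 1; apply: excess_below_root.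
have [[-> ->]|n12] := eqVneq (a, b) (1, 2)%N.
  by constructor 2; rewrite excess_12.
have [[-> ->]|n22] := eqVneq (a, b) (2, 2)%N.
  by constructor 3; rewrite excess_opt.
by constructor 1; apply: excess_at_root.
Qed.

Lemma excess_ge0 n c a b : 32 <= n -> (0 < a + b)%N -> 0 <= excess n c a b.
Proof.
by move=> n32 /(excess_trichotomy c n32)[/ltW//|->|[->]//]; lra.
Qed.

Lemma excess_eq0 n c a b : 32 < n -> (0 < a + b)%N -> excess n c a b = 0 ->
  [/\ c = 0, a = 2 & b = 2]%N.
Proof.
move=> n32 /(excess_trichotomy c (ltW n32))[E|->|[]//]; last by lra.
by move=> E0; rewrite E0 ltxx in E.
Qed.

End Excess.

(** * Optimal leaders *)

Section Optimal.

Variables (R : realType) (T : finType) (e : rel T) (r : T) (h : nat).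
Hypothesis hT : perfect_binary_tree e r h.
Hypothesis h4 : (4 <= h)%N.

Let e_tree : tree e. Proof. by case: hT. Qed.
Let e_conn : connected e. Proof. by case: e_tree. Qed.
Let e_sym : symmetric e. Proof. by case: e_tree => -[]. Qed.

Local Notation N := (2 ^+ h.+1 : R).
Local Notation opt := ((N * (h%:R - 17 / 8) + 7) / 2 : R).
Local Notation lev := (level e r).

Lemma pow_height_ge k : (k <= h)%N -> 2 ^+ k.+1 <= N.
Proof. by move=> kh; rewrite ler_weXn2l // (ler1n R 2). Qed.

Lemma N_ge32 : 32 <= N.
Proof. by apply: le_trans (pow_height_ge h4); rewrite !exprS expr0; lra. Qed.

Lemma apex_dist_gt0 z x y : x != y -> apex e r z x y ->
  (0 < dist e z x + dist e z y)%N.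
Proof. by move=> xy [_ _ <-]; rewrite lt0n dist_eq0. Qed.

Lemma opt_le_pair x y : x != y -> opt <= R_NF e R [set x; y].
Proof.
move=> xy; have [z zxy] := apex_exists r e_tree x y.
rewrite (R_NF2_excess R hT xy zxy) lerDl divr_ge0 //.
exact: excess_ge0 N_ge32 (apex_dist_gt0 xy zxy).
Qed.

(** A single leader is beaten by any pair containing it. *)
Lemma opt_lt_single x : opt < R_NF e R [set x].
Proof.
have /card_gt1P[a [b [_ _ ab]]] : (1 < #|T|)%N.
  by rewrite -ltnS (card_tree hT) (@ltn_exp2l 2 1); lia.
have [y xy] : exists y, x != y.
  by have [xa|xa] := eqVneq x a; [exists b; rewrite xa|exists a].
exact: le_lt_trans (opt_le_pair xy) (R_NF_second_leader R e_tree xy).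
Qed.

Lemma leaders_cases (S : {set T}) : S != set0 -> (#|S| <= 2)%N ->
  (exists x, S = [set x]) \/ exists x y, x != y /\ S = [set x; y].
Proof.
rewrite -card_gt0; case dS: #|S| => [|[|[|k]]] // _ _.
  by left; apply/cards1P; rewrite dS.
by right; apply/cards2P; rewrite dS.
Qed.

Lemma opt_le (S : {set T}) : S != set0 -> (#|S| <= 2)%N -> opt <= R_NF e R S.
Proof.
move=> S0 S2; have [[x ->]|[x [y [xy ->]]]] := leaders_cases S0 S2.
  exact: ltW (opt_lt_single x).
exact: opt_le_pair.
Qed.

Lemma exists_grandchildren_apart :
  exists x y, [/\ apex e r r x y, lev x = 2 & lev y = 2]%N.
Proof.
have lev_r : lev r = 0%N by apply: distnn.
have two_children v : (lev v < h)%N -> exists w1 w2,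
    [/\ w1 \in children e r v, w2 \in children e r v & w1 != w2].
  move/(card_child hT) => c2; have /card_gt1P[w1 [w2 [? ? ?]]] :
    (1 < #|children e r v|)%N by rewrite c2.
  by exists w1, w2.
have [|w1 [w2 [w1r w2r w12]]] := two_children r; first by rewrite lev_r; lia.
have [_ l1] := childP _ _ _ _ w1r; have [_ l2] := childP _ _ _ _ w2r.
rewrite lev_r in l1 l2.
have [|x [_ [xw _ _]]] := two_children w1; first by rewrite l1; lia.
have [|y [_ [yw _ _]]] := two_children w2; first by rewrite l2; lia.
have ax : ancestor e r w1 x by apply: connect1.
have ay : ancestor e r w2 y by apply: connect1.
have nay : ~~ ancestor e r w1 y.
  apply: contra w12 => ay1; apply/eqP.
  exact: (ancestor_child_unique e_tree w1r w2r ay1 ay).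
exists x, y; split.
- split; rewrite ?(ancestor_root r e_tree) //.
  by rewrite (dist_across e_tree w1r ax nay) [dist e x r]distC.
- by case/childP: xw => _ ->; rewrite l1.
- by case/childP: yw => _ ->; rewrite l2.
Qed.

Lemma R_NF_opt x y : apex e r r x y -> lev x = 2%N -> lev y = 2%N ->
  R_NF e R [set x; y] = opt.
Proof.
move=> rxy lx ly; have xy : x != y.
  by rewrite -(dist_eq0 e_conn); case: rxy => _ _ ->; rewrite -/(lev x) lx.
rewrite (R_NF2_excess R hT xy rxy) -/(lev x) -/(lev y) lx ly /level distnn.
by rewrite excess_opt mul0r addr0.
Qed.

(** Height above 4 excludes the tie with depths 1 and 2 below the root. *)
Lemma opt_shape (S : {set T}) : (4 < h)%N -> S != set0 -> (#|S| <= 2)%N ->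
  R_NF e R S = opt ->
  exists x y, [/\ S = [set x; y], apex e r r x y, lev x = 2 & lev y = 2]%N.
Proof.
move=> h5 S0 S2; have [[x ->]|[x [y [xy ->]]]] := leaders_cases S0 S2.
  by move=> E; have := opt_lt_single x; rewrite E ltxx.
have [z zxy] := apex_exists r e_tree x y.
rewrite (R_NF2_excess R hT xy zxy) => E.
have N32 : 32 < N.
  by apply: lt_le_trans (pow_height_ge h5); rewrite !exprS expr0; lra.
have [lz zx zy] : [/\ lev z = 0, dist e z x = 2 & dist e z y = 2]%N.
  by apply: (excess_eq0 N32 (apex_dist_gt0 xy zxy)); lra.
have zr := root_of_level0 e_tree lz; rewrite zr in zxy zx zy.
by exists x, y.
Qed.

Lemma opt_log2 :
  opt = (#|T|%:R + 1) / 2 * (log2 (#|T|%:R + 1) - 25 / 8) + 7 / 2.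
Proof.
rewrite (natr_card_tree R hT) subrK /log2 lnXn // -[ln _ *+ _]mulr_natl.
have ln2 : ln 2 != 0 :> R by rewrite gt_eqF // ln_gt0 // ltr1n.
by rewrite mulfK // -natr1; field.
Qed.

End Optimal.

Theorem theorem12 (R : realType) (T : finType) (e : rel T) (r : T) (h : nat)
    (hT : perfect_binary_tree e r h) (h4 : (4 <= h)%N) :
  let n : R := #|T|%:R in
  [/\ exists x y : T,
        [/\ lowest_common_ancestor e r r x y, (level e r x <= level e r y)%N,
            dist e x y = 4%N & dist e x r = 2%N],
      forall x y : T,
        lowest_common_ancestor e r r x y -> (level e r x <= level e r y)%N ->
        dist e x y = 4%N -> dist e x r = 2%N ->
        nf_optimal e R 2 [set x; y] /\
        R_NF e R [set x; y] = (n + 1) / 2 * (log2 (n + 1) - 25 / 8) + 7 / 2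
    & (4 < h)%N -> forall S : {set T}, nf_optimal e R 2 S ->
        exists x y : T,
          [/\ S = [set x; y], lowest_common_ancestor e r r x y,
              (level e r x <= level e r y)%N,
              dist e x y = 4%N & dist e x r = 2%N]].
Proof.
move=> n.
have e_tree : tree e by case: hT.
have e_conn : connected e by case: e_tree.
have e_sym : symmetric e by case: e_tree => -[].
have lcaP x y := apex_root_lca r e_tree x y.
have dist_shape x y : apex e r r x y -> level e r x = 2%N -> level e r y = 2%N ->
    [/\ lowest_common_ancestor e r r x y, (level e r x <= level e r y)%N,
        dist e x y = 4%N & dist e x r = 2%N].
  move=> rxy lx ly; split; rewrite ?lx ?ly //; first exact/lcaP.
    by case: rxy => _ _ ->; rewrite -!/(level e r _) lx ly.
  by rewrite distC.
have [x0 [y0 [rxy0 lx0 ly0]]] := exists_grandchildren_apart hT h4.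
split; first by exists x0, y0; apply: dist_shape.
- move=> x y /lcaP rxy _ dxy dxr.
  have lx : level e r x = 2%N by rewrite /level distC.
  have ly : level e r y = 2%N.
    by case: rxy => _ _; rewrite dxy -!/(level e r _) lx => -[].
  have E := R_NF_opt R hT rxy lx ly.
  split; last by rewrite E (opt_log2 R hT).
  split=> [||S S0 S2]; first by apply/set0Pn; exists x; apply: set21.
    by rewrite cards2; case: (x != y).
  by rewrite E; apply: (opt_le R hT h4).
- move=> h5 S [S0 S2 Smin].
  have E : R_NF e R S = (2 ^+ h.+1 * (h%:R - 17 / 8) + 7) / 2.
    apply/eqP; rewrite eq_le (opt_le R hT h4) // andbT -(R_NF_opt R hT rxy0 lx0 ly0).
    apply: Smin; last by rewrite cards2; case: (x0 != y0).
    by apply/set0Pn; exists x0; apply: set21.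
  have [x [y [-> rxy lx ly]]] := opt_shape hT h4 h5 S0 S2 E.
  by exists x, y; have [] := dist_shape x y rxy lx ly.
Qed.
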